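(* Let $G=(V,E,\omega)$ be a graph and $S\in st(G)$. If each vertex of $G$ lies on a branch in $\mathcal{B}_S(G)$, then $G$ and its branch expansion $\mathcal{X}_S(G)$ have the same weight set, $\mathcal{R}_S(\mathcal{X}_S(G))=\mathcal{R}_S(G)$, and $|\mathcal{X}_S(G)|\ge|G|$. Moreover, $$\det\big(M(\mathcal{X}_S(G))-\lambda I\big)=\det\big(M(G)-\lambda I\big)\prod_{v_i\in\bar S}\big(\omega(e_{ii})-\lambda\big)^{n_i-1},$$ where $n_i$ is the number of branches in $\mathcal{B}_S(G)$ containing $v_i$.
   Context: Let $\mathbb{W}$ be the field of rational functions in a complex variable $\lambda$ with complex coefficients. A graph $G=(V,E,\omega)$ is a finite directed graph with vertex set $V$, edges $E$ (loops allowed, at most one edge $e_{ij}$ from $v_i$ to $v_j$), weights $\omega:E\to\mathbb{W}\setminus\{0\}$, $\omega(e_{ij})=0$ for non-edges; $M(G)_{ij}=\omega(e_{ij})$; $|G|$ is the number of vertices; the weight set of $G$ is $\omega(E)$. $\bar S=V\setminus S$; $\ell(G)$ is $G$ without loops. A path is a sequence of distinct vertices $u_1,\dots,u_m$ ($m\ge2$) with edges $u_k\to u_{k+1}$; a cycle is the same with $u_1=u_m$, $u_1,\dots,u_{m-1}$ distinct; $u_2,\dots,u_{m-1}$ are interior. A nonempty $S\subseteq V$ is a structural set ($S\in st(G)$) if $\ell(G)|_{\bar S}$ has no cycles and $\omega(e_{ii})\neq\lambda$ for $v_i\in\bar S$. For $v_i,v_j\in S$, $\mathcal{B}_{ij}(G;S)$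 is the set of paths or cycles from $v_i$ to $v_j$ with no interior vertex in $S$, and $\mathcal{B}_S(G)=\bigcup_{i,j}\mathcal{B}_{ij}(G;S)$ is the set of branches. For $\beta=u_1,\dots,u_m$, $\mathcal{P}_\omega(\beta)=\omega(u_1u_2)\prod_{k=2}^{m-1}\frac{\omega(u_ku_{k+1})}{\lambda-\omega(u_ku_k)}$, and the isospectral reduction $\mathcal{R}_S(G)$ is the graph on $S$ with an edge $v_i\to v_j$ iff $\mathcal{B}_{ij}(G;S)\ne\emptyset$, of weight $\sum_{\beta\in\mathcal{B}_{ij}(G;S)}\mathcal{P}_\omega(\beta)$. For a branch $\beta=u_1,\dots,u_m$ let $\Omega(\beta)$ be the sequence $\omega(u_1u_2),\omega(u_2u_2),\omega(u_2u_3),\omega(u_3u_3),\dots,\omega(u_{m-1}u_{m-1}),\omega(u_{m-1}u_m)$ (with $0$ for absent loops). Two branches are independent if they share no interior vertex. For $S=\{v_1,\dots,v_m\}\in st(G)$ the branch expansion $\mathcal{X}_S(G)$ is the graph (unique up to labeling of the vertices outside $S$) containing $S$ in its vertex set, with $S\in st(\mathcal{X}_S(G))$, such that: (i) for all $i,j$ there are bijections $b_{ij}:\mathcal{B}_{ij}(\mathcal{X}_S(G);S)\to\mathcal{B}_{ij}(G;S)$ with $\Omega(\gamma)=\Omega(b_{ij}(\gamma))$; (ii) the branches in $\mathcal{B}_S(\mathcal{X}_S(G))$ are pairwise independent; (iii) each vertex of $\mathcal{X}_S(G)$ lies on a branch in $\mathcal{B}_S(\mathcal{X}_S(G))$. 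*)

(* Defs.v *)
(* Graphs with weights in the field W = C(lambda) of
   complex rational functions.  A graph on n vertices v_0..v_{n-1} ('I_n)
   is encoded by its weighted adjacency matrix M : 'M[W]_n; the edge
   e_ij exists iff M i j != 0 (weights of edges are nonzero by definition). *)
From HB Require Import structures.
From mathcomp Require Import all_boot all_order all_algebra.
From mathcomp Require Import complex Rstruct.
Set Implicit Arguments. Unset Strict Implicit. Unset Printing Implicit Defensive.
Import Order.TTheory GRing.Theory Num.Theory.
Local Open Scope ring_scope.

Definition Cx := (Rdefinitions.R)[i].
Definition W := {fraction {poly Cx}}.
Definition lam : W := FracField.tofrac ('X : {poly Cx}).

Section Graphs.
Variable n : nat.
Implicit Types (M : 'M[W]_n) (S : {set 'I_n}).

Definition edge M (u v : 'I_n) : bool := M u v != 0.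
Definition edge_noloop M (u v : 'I_n) : bool := (u != v) && (M u v != 0).

Definition acyclic_off M S : Prop :=
  forall (a : 'I_n) (p : seq 'I_n),
    a \notin S -> all (fun v => v \notin S) p -> uniq (a :: p) ->
    path (edge_noloop M) a p -> ~~ edge_noloop M (last a p) a.

Definition structural M S : Prop :=
  S != set0 /\ acyclic_off M S /\ (forall i, i \notin S -> M i i != lam).

(* The sequence  i, p_1, ..., p_k, j  is a branch in B_ij(G;S): i, j in S,
   interior p outside S, consecutive edges, and it is a path (all vertices
   distinct) or a cycle (i = j, i, p_1, ..., p_k distinct).  Since the
   interior avoids S and i, j are in S, this amounts to uniq (i :: p). *)
Definition is_branch M S (i : 'I_n) (p : seq 'I_n) (j : 'I_n) : bool :=
  [&& i \in S, j \in S, all (fun v => v \notin S) p,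
      uniq (i :: p) & path (edge M) i (rcons p j)].

Definition branch_verts (i : 'I_n) (p : seq 'I_n) (j : 'I_n) : seq 'I_n :=
  i :: rcons p j.

Definition Pw M (i : 'I_n) (p : seq 'I_n) (j : 'I_n) : W :=
  (\prod_(e <- zip (i :: p) (rcons p j)) M e.1 e.2) *
  \prod_(v <- p) (lam - M v v)^-1.

Fixpoint Omega M (a : 'I_n) (p : seq 'I_n) (j : 'I_n) : seq W :=
  match p with
  | [::] => [:: M a j]
  | u :: p' => M a u :: M u u :: Omega M u p' j
  end.

(* Isospectral reduction R_S(G), for i, j in S: the edge i -> j exists iff
   B_ij(G;S) is nonempty, and its weight is the sum of P_omega over B_ij.
   Since interiors are duplicate-free, their length is at most n, so
   enumerating interiors as k-tuples, k <= n, enumerates B_ij(G;S). *)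
Definition red_edge M S (i j : 'I_n) : bool :=
  [exists k : 'I_n.+1, exists t : (nat_of_ord k).-tuple 'I_n,
     is_branch M S i t j].
Definition red_weight M S (i j : 'I_n) : W :=
  \sum_(k < n.+1) \sum_(t : (nat_of_ord k).-tuple 'I_n | is_branch M S i t j)
     Pw M i t j.

Definition nbranch_through M S (v : 'I_n) : nat :=
  \sum_(i < n) \sum_(j < n) \sum_(k < n.+1)
    #|[pred t : (nat_of_ord k).-tuple 'I_n |
        is_branch M S i t j && (v \in branch_verts i t j)]|.

Definition covered_by_branches M S : Prop :=
  forall v : 'I_n, exists i p j, is_branch M S i p j /\ v \in branch_verts i p j.

Definition branches_independent M S : Prop :=
  forall i p j i' p' j',
    is_branch M S i p j -> is_branch M S i' p' j' ->
    (i, p, j) != (i', p', j') -> forall v, v \in p -> v \notin p'.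

Definition weight_set M : W -> Prop :=
  fun w => exists i j : 'I_n, M i j != 0 /\ M i j = w.

End Graphs.

(* X : 'M[W]_N together with emb : 'I_n -> 'I_N (identifying S with a subset
   emb @: S of the vertex set of X) is a branch expansion X_S(G) of
   G = M with respect to S. *)
Definition is_branch_expansion (n N : nat) (M : 'M[W]_n) (S : {set 'I_n})
    (X : 'M[W]_N) (emb : 'I_n -> 'I_N) : Prop :=
  {in S &, injective emb} /\
  structural X (emb @: S) /\
  (forall i j, i \in S -> j \in S ->
     exists b : seq 'I_N -> seq 'I_n,
       (forall q, is_branch X (emb @: S) (emb i) q (emb j) ->
          is_branch M S i (b q) j /\
          Omega X (emb i) q (emb j) = Omega M i (b q) j) /\
       {in [pred q | is_branch X (emb @: S) (emb i) q (emb j)] &,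
          injective b} /\
       (forall p, is_branch M S i p j ->
          exists2 q, is_branch X (emb @: S) (emb i) q (emb j) & b q = p)) /\
  branches_independent X (emb @: S) /\
  covered_by_branches X (emb @: S).

(* Main.v *)
Require Import Defs.
From mathcomp Require Import all_boot all_order all_algebra fingroup perm.
Import GRing.Theory.
Set Implicit Arguments.
Unset Strict Implicit.
Unset Printing Implicit Defensive.
Local Open Scope ring_scope.

(* Let q_(u,j) be the sum of P_omega over the paths from u to j in S with
   interior off S.  Splitting off the first step gives
     q_(u,j) = M_(u,j) + sum_(v off S, v <> u) M_(u,v) / (lambda - M_(v,v)) q_(v,j),
   so right multiplication of M - lambda by the unipotent matrix with entries
   q_(u,j) / (lambda - M_(u,u)), u off S and j in S, makes it block triangular,
   with blocks R_S(M) - lambda and M|_(off S) - lambda; the latter is acyclic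
   up to loops.  Hence
     det (M - lambda) = det (R_S(M) - lambda) * prod_(v off S) (M_(v,v) - lambda).
   Reductions are determined by the sequences Omega, hence agree for G and its
   expansion, and in the expansion every v off S is replaced by n_v copies, one
   for each branch through v. *)

(** * Determinants *)

(** An injection between index sets of equal size is a permutation; applied to rows and columns at
    once, its sign enters squared. *)
Lemma det_mxsub_inj (R : comNzRingType) (m n : nat) (f : 'I_m -> 'I_n)
    (A : 'M[R]_n) :
  injective f -> m = n -> \det (mxsub f f A) = \det A.
Proof.
move=> f_inj eq_mn; case: _ / eq_mn f f_inj A => f f_inj A.
have -> : mxsub f f A = row_perm (perm f_inj) (col_perm (perm f_inj) A).
  by apply/matrixP=> i j; rewrite !mxE !permE.
rewrite row_permE col_permE !det_mulmx !det_perm odd_permV mulrCA -signr_addb.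
by rewrite addbb mulr1.
Qed.

Lemma det_block_triangular (R : comNzRingType) (n m k : nat) (f : 'I_m -> 'I_n)
    (g : 'I_k -> 'I_n) (A : 'M[R]_n) :
  injective f -> injective g -> (forall i j, f i != g j) -> (m + k)%N = n ->
  (forall i j, A (g i) (f j) = 0) ->
  \det A = \det (mxsub f f A) * \det (mxsub g g A).
Proof.
move=> f_inj g_inj fg eq_n A0.
pose h (i : 'I_(m + k)) := match split i with inl i => f i | inr i => g i end.
have hl i : h (lshift k i) = f i by rewrite /h (unsplitK (inl i)).
have hr i : h (rshift m i) = g i by rewrite /h (unsplitK (inr i)).
have h_inj : injective h.
  move=> x y; case: (split_ordP x) => i ->; case: (split_ordP y) => j ->;
    rewrite ?hl ?hr.
  - by move=> /f_inj ->.
  - by move=> E; have := fg i j; rewrite E eqxx.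
  - by move=> E; have := fg j i; rewrite E eqxx.
  - by move=> /g_inj ->.
rewrite -(det_mxsub_inj A h_inj eq_n) -(det_ublock _ (mxsub f g A)).
congr (\det _).
rewrite -[LHS]submxK; congr block_mx; apply/matrixP=> i j;
  by rewrite !mxE ?hl ?hr.
Qed.

(** In the Leibniz expansion a permutation other than the identity moves some point, and a nonzero
    term would turn the orbit of that point into a loopless cycle in the support of [A]. *)
Lemma det_acyclic (R : idomainType) (n : nat) (A : 'M[R]_n) :
  (forall a p, uniq (a :: p) -> path (fun i j => (i != j) && (A i j != 0)) a p ->
     (last a p == a) || (A (last a p) a == 0)) ->
  \det A = \prod_i A i i.
Proof.
move=> acyc; rewrite /determinant (bigD1 1%g) //= odd_perm1 mul1r.
rewrite [X in _ + X]big1 ?addr0 => [|s s1].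
  by apply: eq_bigr => i _; rewrite perm1.
have [x sx] : exists x, s x != x.
  apply/existsP; apply: contraR s1; rewrite negb_exists => /forallP s1.
  by apply/eqP/permP=> x; rewrite perm1; apply/eqP/negPn.
apply/eqP; rewrite mulf_eq0 signr_eq0 /=; apply/negPn/negP => nz.
have A_nz i : A i (s i) != 0.
  by apply: contraNneq nz => Ai0; rewrite (bigD1 i) //= Ai0 mul0r.
have := cycle_orbit (@perm_inj _ s) x; have := orbit_uniq s x.
have : x \in orbit s x by rewrite -fconnect_orbit.
case E: (orbit s x) => [|a p] // _ uap.
have step y : y \in a :: p -> y != s y.
  rewrite -E -fconnect_orbit => xy.
  apply: contra sx => /eqP ys; have: fconnect s y x.
    by rewrite fconnect_sym //; apply: perm_inj.
  move=> /iter_findex <-; have -> m : iter m s y = y by elim: m => //= m ->.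
  by rewrite -ys.
rewrite /= rcons_path => /andP[pth lst].
have /orP[] : (last a p == a) || (A (last a p) a == 0).
- apply: acyc => //; apply: (sub_in_path (P := mem (a :: p))) pth.
    by move=> y z yp zp /eqP <-; rewrite step // A_nz.
  exact/allP.
- by have := step _ (mem_last a p); rewrite (eqP lst) => /negPf->.
- by rewrite -[a in A _ a](eqP lst) (negPf (A_nz _)).
Qed.

(** Separates the linear algebra from the combinatorics of paths: [Q] stands for the path sums,
    known here only through their first-step recursion. *)
Lemma det_schur (K : fieldType) (n m : nat) (M : 'M[K]_n) (l : K)
    (S : {set 'I_n}) (f : 'I_m -> 'I_n) (Q : 'I_n -> 'I_n -> K) :
  injective f -> (forall i, f i \in S) -> #|S| = m ->
  (forall u, u \notin S -> M u u != l) ->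
  (forall a p, all (fun v => v \notin S) (a :: p) -> uniq (a :: p) ->
     path (fun u v => (u != v) && (M u v != 0)) a p ->
     (last a p == a) || (M (last a p) a == 0)) ->
  (forall a j, j \in S -> Q a j = M a j +
     \sum_(u | (u \notin S) && (a != u)) M a u / (l - M u u) * Q u j) ->
  \det (M - l%:M) = \det (\matrix_(i, j) (Q (f i) (f j) - l *+ (i == j))) *
    \prod_(v | v \notin S) (M v v - l).
Proof.
move=> f_inj fS cardS Mnl acyc Qstep.
pose g (k : 'I_#|~: S|) : 'I_n := enum_val k.
have g_inj : injective g by exact: enum_val_inj.
have gS k : g k \notin S by have := enum_valP k; rewrite inE.
have fg i j : f i != g j by apply: contraNneq (gS j) => <-.
have gf i j : g i != f j by rewrite eq_sym.
have card_mk : (m + #|~: S|)%N = n by rewrite -cardS cardsC card_ord.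
have card_km : (#|~: S| + m)%N = n by rewrite addnC.
(* Right multiplication by [1 + Y] adds multiples of columns off [S] to columns in [S], which
   preserves the determinant. *)
pose Y : 'M[K]_n :=
  \matrix_(u, j) if (u \notin S) && (j \in S) then Q u j / (l - M u u) else 0.
have detU : \det (1%:M + Y) = 1.
  rewrite (det_block_triangular g_inj f_inj gf card_km) => [|i j].
    have -> : mxsub g g (1%:M + Y) = 1%:M.
      apply/matrixP=> i j; rewrite !mxE (inj_eq g_inj).
      by rewrite (negPf (gS j)) andbF addr0.
    have -> : mxsub f f (1%:M + Y) = 1%:M.
      by apply/matrixP=> i j; rewrite !mxE (inj_eq f_inj) fS addr0.
    by rewrite !det1 mulr1.
  by rewrite !mxE fS (negPf (fg i j)) addr0.
pose V := (M - l%:M) *m (1%:M + Y).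
have -> : \det (M - l%:M) = \det V by rewrite det_mulmx detU mulr1.
have VE a b : V a b = M a b - l *+ (a == b) +
    \sum_u (M a u - l *+ (a == u)) * Y u b.
  rewrite /V mulmxDr mulmx1 !mxE; congr (_ + _).
  by apply: eq_bigr => u _; rewrite !mxE.
clearbody V.
have VS a b : b \in S -> V a b = M a b - l *+ (a == b) +
    \sum_(u | u \notin S) (M a u - l *+ (a == u)) * (Q u b / (l - M u u)).
  move=> bS; rewrite VE; congr (_ + _); rewrite [RHS]big_mkcond /=.
  by apply: eq_bigr => u _; rewrite mxE bS andbT; case: ifP; rewrite ?mulr0.
have V_g a b : b \notin S -> V a b = M a b - l *+ (a == b).
  move=> /negPf bS; rewrite VE big1 ?addr0 // => u _.
  by rewrite mxE bS andbF mulr0.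
rewrite (det_block_triangular f_inj g_inj fg card_mk) => [|i j].
  congr (\det _ * _).
    apply/matrixP=> i j; rewrite !mxE VS // (inj_eq f_inj) Qstep //.
    rewrite [RHS]addrAC; congr (_ + _); apply: eq_big => u.
      by rewrite andb_idr // => uS; apply: contraNneq uS => <-.
    move=> uS; have /negPf-> : f i != u by apply: contraNneq uS => <-.
    by rewrite subr0 mulrA mulrAC.
  rewrite det_acyclic => [|a p up pth].
    transitivity (\prod_(v in ~: S) (M v v - l)); last first.
      by apply: eq_bigl => v; rewrite inE.
    rewrite [RHS]big_enum_val; apply: eq_bigr => i _.
    by rewrite mxE V_g // eqxx.
  have gp : path (fun u v => (u != v) && (M u v != 0)) (g a) (map g p).
    rewrite path_map; apply: sub_path pth => i j /=.
    by rewrite !mxE V_g // (inj_eq g_inj); case: eqP => //= _; rewrite subr0.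
  have := acyc (g a) (map g p) _ _ gp.
  rewrite -map_cons map_inj_uniq // last_map (inj_eq g_inj) !mxE V_g //.
  rewrite (inj_eq g_inj); case: eqP => //= _; rewrite subr0; apply => //.
  by rewrite gS; apply/allP=> _ /mapP[y _ ->].
(* In the lower left block the summand at [g i] is [- Q (g i) (f j)], as the diagonal entry cancels
   the denominator up to sign; the recursion for [Q] at [g i] then makes the entry vanish. *)
rewrite VS // (bigD1 (g i)) //= eqxx mulr1n.
rewrite -[M (g i) (g i) - l]opprB mulNr mulrCA divff; last first.
  by rewrite subr_eq0 eq_sym Mnl.
rewrite mulr1 (negPf (gf i j)) subr0 addrA Qstep // opprD addrA subrr add0r.
apply/eqP; rewrite addrC subr_eq0; apply/eqP/eq_big => u; first by rewrite eq_sym.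
move=> /andP[_ /negPf ui]; rewrite [g i == u]eq_sym ui subr0.
by rewrite mulrA [RHS]mulrAC.
Qed.

(** * Isospectral reduction *)

Lemma Pw_nil (n : nat) (M : 'M[W]_n) (a j : 'I_n) : Pw M a [::] j = M a j.
Proof. by rewrite /Pw /= big_seq1 big_nil mulr1. Qed.

Lemma Pw_cons (n : nat) (M : 'M[W]_n) (a u j : 'I_n) (p : seq 'I_n) :
  Pw M a (u :: p) j = M a u / (lam - M u u) * Pw M u p j.
Proof. by rewrite /Pw /= !big_cons mulrACA. Qed.

Lemma Pw_eq0 (n : nat) (M : 'M[W]_n) (a j : 'I_n) (p : seq 'I_n) :
  ~~ path (edge M) a (rcons p j) -> Pw M a p j = 0.
Proof.
elim: p a => [|u p IHp] a /=; first by rewrite andbT negbK Pw_nil => /eqP.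
rewrite Pw_cons negb_and negbK => /orP[/eqP->|/IHp->].
  by rewrite !mul0r.
by rewrite mulr0.
Qed.

Lemma edge_noloopE (n : nat) (M : 'M[W]_n) (u v : 'I_n) :
  edge_noloop M u v = (u != v) && edge M u v.
Proof. reflexivity. Qed.

(** Distinctness can fail only through a cycle off [S], and acyclicity leaves just loops. So it
    becomes a condition on consecutive vertices, which lets path sums be split at the first step. *)
Lemma acyclic_uniq (n : nat) (M : 'M[W]_n) (S : {set 'I_n}) (a : 'I_n)
    (p : seq 'I_n) :
  acyclic_off M S -> path (edge M) a p ->
  all (fun v => v \notin S) p && uniq (a :: p) =
  path (fun u v => (v \notin S) && (u != v)) a p.
Proof.
move=> acyc; elim: p a => [|u p IHp] a //= /andP[au pth].
rewrite -IHp // {IHp} /=.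
case uS: (u \notin S) => //=; case: (boolP (all _ p)) => [pS|]; last first.
  by rewrite !andbF.
case: (boolP (uniq p)) => up; last by rewrite !andbF.
case: (boolP (u \in p)) => unp; first by rewrite !andbF.
rewrite !andbT in_cons negb_or.
rewrite andTb andb_idr // => nau; apply/negP => ap.
(* The return to [a] shows that [a] itself is off [S], so acyclicity applies to the cycle [a], [u],
   [p1]. *)
move: ap pth pS unp up; case/splitPr=> p1 p2.
rewrite cat_path cat_uniq all_cat mem_cat negb_or /=.
move=> /andP[pth /andP[lst _]] /and3P[pS aS _] /andP[up1 _] /and3P[Up1].
rewrite negb_or => /andP[ap1 _] _.
have Uaup1 : uniq (a :: u :: p1) by rewrite /= in_cons negb_or nau ap1 up1.
have noloop x q : uniq (x :: q) -> path (edge M) x q -> path (edge_noloop M) x q.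
  elim: q x => //= y q IHq x /andP[]; rewrite in_cons negb_or => /andP[xy _].
  by move=> Uyq /andP[exy pq]; rewrite edge_noloopE xy exy IHq.
have pS1 : all (fun v => v \notin S) (u :: p1) by rewrite /= uS.
have ned : path (edge_noloop M) a (u :: p1) by apply: noloop => //=; rewrite au.
have := acyc a (u :: p1) aS pS1 Uaup1 ned.
rewrite edge_noloopE /= lst andbT negbK => /eqP la; move: Uaup1.
by rewrite -la cons_uniq mem_last.
Qed.

Lemma big_tuple_cons (R : Type) (idx : R) (op : Monoid.com_law idx)
    (T : finType) (k : nat) (P : pred (seq T)) (F : seq T -> R) :
  \big[op/idx]_(t : k.+1.-tuple T | P t) F t =
  \big[op/idx]_(x : T) \big[op/idx]_(t : k.-tuple T | P (x :: t)) F (x :: t).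
Proof.
rewrite pair_big_dep /=.
rewrite (reindex (fun y : T * k.-tuple T => [tuple of y.1 :: y.2])) //=.
exists (fun t => (thead t, [tuple of behead t])) => [[x t] _ | t _] /=.
  by congr (_, _); apply: val_inj.
by rewrite -tuple_eta.
Qed.

Section BranchSums.

Variables (n : nat) (M : 'M[W]_n) (S : {set 'I_n}).
Hypothesis acyc : acyclic_off M S.

Let offS (u v : 'I_n) := (v \notin S) && (u != v).

(** Edges are not tested, since [Pw] vanishes at a non-edge, and [a] may lie off [S]: this keeps the
    recursion free of side conditions. *)
Let Hk (k : nat) (a j : 'I_n) : W :=
  \sum_(t : k.-tuple 'I_n | path offS a t) Pw M a t j.

Definition branch_sum (a j : 'I_n) : W := \sum_(k < n.+1) Hk k a j.

Lemma red_weightE i j : i \in S -> j \in S -> red_weight M S i j = branch_sum i j.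
Proof.
move=> iS jS; apply: eq_bigr => k _; rewrite big_mkcond [RHS]big_mkcond.
apply: eq_bigr => t _.
case: (boolP (path (edge M) i (rcons t j))) => [pth|/Pw_eq0->];
  last by rewrite !if_same.
rewrite /is_branch iS jS pth andbT [uniq _]lock /= -lock (acyclic_uniq acyc) //.
by move: pth; rewrite rcons_path => /andP[].
Qed.

Let Hk0 a j : Hk 0 a j = M a j.
Proof.
rewrite /Hk (big_pred1 [tuple]) => [|t]; first by rewrite Pw_nil.
by rewrite tuple0 /= eqxx.
Qed.

Let HkS k a j :
  Hk k.+1 a j = \sum_(u | offS a u) M a u / (lam - M u u) * Hk k u j.
Proof.
rewrite /Hk (big_tuple_cons _ _ (path offS a) (fun t => Pw M a t j)) /=.
rewrite [RHS]big_mkcond; apply: eq_bigr => u _; case: (offS a u).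
  by rewrite big_distrr; apply: eq_bigr => t _; rewrite Pw_cons.
by rewrite big_pred0.
Qed.

(** A nonzero term would give [n.+1] distinct vertices: an interior of length [n] and its start. *)
Let Hkn u j : Hk n u j = 0.
Proof.
rewrite /Hk big1 // => t pth; apply: Pw_eq0; apply/negP; rewrite rcons_path.
move=> /andP[ed _]; move: pth; rewrite /offS -(acyclic_uniq acyc) // => /andP[_].
move=> /card_uniqP card_ut; have := max_card (mem (u :: t)).
by rewrite card_ut card_ord /= size_tuple ltnn.
Qed.

Lemma branch_sum_step a j : branch_sum a j = M a j +
  \sum_(u | (u \notin S) && (a != u)) M a u / (lam - M u u) * branch_sum u j.
Proof.
rewrite /branch_sum big_ord_recl Hk0; congr (_ + _).
under eq_bigr => k _ do rewrite HkS.
rewrite exchange_big; apply: eq_bigr => u _.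
(* Removing the first vertex shifts lengths by one; the extra length [n] in the sum at [u]
   contributes 0. *)
by rewrite big_ord_recr /= Hkn addr0 big_distrr.
Qed.

End BranchSums.

(** The enumeration [f] of [S] is left free so that a graph and its expansion can be given reduction
    matrices with matching indices. *)
Lemma det_isospectral_reduction (n m : nat) (M : 'M[W]_n) (S : {set 'I_n})
    (f : 'I_m -> 'I_n) :
  structural M S -> injective f -> (forall i, f i \in S) -> #|S| = m ->
  \det (M - lam%:M) =
    \det (\matrix_(i, j) (red_weight M S (f i) (f j) - lam *+ (i == j))) *
    \prod_(v | v \notin S) (M v v - lam).
Proof.
move=> [_ [acyc Mnl]] f_inj fS cardS.
rewrite (det_schur (Q := branch_sum M S) f_inj fS cardS Mnl).
- congr (\det _ * _); apply/matrixP=> i j; rewrite !mxE.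
  by rewrite red_weightE.
- move=> a p /andP[aS pS] up pth; have := acyc a p aS pS up pth.
  by rewrite negb_and !negbK.
- by move=> a j _; apply: branch_sum_step.
Qed.

(** * Branches *)

Lemma Pw_Omega (n n' : nat) (M : 'M[W]_n) (M' : 'M[W]_n') i p j i' p' j' :
  Omega M i p j = Omega M' i' p' j' -> Pw M i p j = Pw M' i' p' j'.
Proof.
elim: p p' i i' => [|u p IHp] [|u' p'] i i' //=; first by rewrite !Pw_nil => -[].
by rewrite !Pw_cons => -[-> -> /IHp->].
Qed.

Lemma loops_Omega (n n' : nat) (M : 'M[W]_n) (M' : 'M[W]_n') i p j i' p' j' :
  Omega M i p j = Omega M' i' p' j' ->
  [seq M v v | v <- p] = [seq M' v v | v <- p'].
Proof.
elim: p p' i i' => [|u p IHp] [|u' p'] i i' //=.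
by move=> [_ -> /IHp->].
Qed.

Lemma mem_Omega_loop (n : nat) (M : 'M[W]_n) i p j v :
  v \in p -> M v v \in Omega M i p j.
Proof.
elim: p i => // u p IHp i; rewrite in_cons => /predU1P[->|/IHp H].
  by apply/or3P; constructor 2.
by apply/or3P; constructor 3; apply: H.
Qed.

Lemma mem_Omega_edge (n : nat) (M : 'M[W]_n) i p q j :
  M (last i p) (head j q) \in Omega M i (p ++ q) j.
Proof.
elim: p i => [|u p IHp] i; first by case: q => [|u q]; apply: mem_head.
by apply/or3P; constructor 3; apply: IHp.
Qed.

Lemma mem_Omega_entry (n : nat) (M : 'M[W]_n) i p j w :
  w \in Omega M i p j -> exists u v, M u v = w.
Proof.
elim: p i => [|u p IHp] i /=.
  by rewrite inE => /eqP->; exists i, j.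
by rewrite !inE => /or3P[/eqP->|/eqP->|/IHp//]; [exists i, u | exists u, u].
Qed.

Lemma size_branch (n : nat) (M : 'M[W]_n) (S : {set 'I_n}) i p j :
  is_branch M S i p j -> (size p <= n)%N.
Proof.
case/and5P=> _ _ _ /card_uniqP card_ip _; apply: ltnW.
by have := max_card (mem (i :: p)); rewrite card_ip card_ord.
Qed.

Section Branches.

Variables (n : nat) (M : 'M[W]_n) (S : {set 'I_n}).

Lemma branch_interior i p j v :
  is_branch M S i p j -> v \notin S -> (v \in branch_verts i p j) = (v \in p).
Proof.
case/and5P=> iS jS _ _ _ vS; rewrite /branch_verts in_cons mem_rcons in_cons.
by rewrite !(negPf (contraNneq _ vS)) // => ->.
Qed.

(** Interiors of all lengths share one duplicate-free list, so that a bijection between the branches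
    of two graphs becomes a permutation of lists. *)
Definition branches i j : seq (seq 'I_n) :=
  [seq p <- [seq tval t | k : 'I_n.+1 <- enum 'I_n.+1,
                       t : k.-tuple 'I_n <- enum {: k.-tuple 'I_n}] |
     is_branch M S i p j].

Lemma mem_branches i j p : (p \in branches i j) = is_branch M S i p j.
Proof.
rewrite mem_filter andb_idr // => /size_branch; rewrite -ltnS => lt_p.
apply/allpairsPdep; exists (Ordinal lt_p), (in_tuple p).
by rewrite !mem_enum.
Qed.

Lemma branches_uniq i j : uniq (branches i j).
Proof.
apply/filter_uniq/allpairs_uniq_dep => [|k _|]; rewrite ?enum_uniq //.
move=> [k t] [k' t'] _ _ /= tt'.
have kk' : k = k' by apply: val_inj; rewrite /= -(size_tuple t) tt' size_tuple.
by case: _ / kk' t' tt' => t' /val_inj->.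
Qed.

Lemma big_branches (R : Type) (idx : R) (op : Monoid.com_law idx) i j
    (F : seq 'I_n -> R) :
  \big[op/idx]_(p <- branches i j) F p =
  \big[op/idx]_(k < n.+1) \big[op/idx]_(t : k.-tuple 'I_n | is_branch M S i t j) F t.
Proof.
rewrite big_filter big_mkcond big_allpairs_dep big_enum; apply: eq_bigr => k _.
by rewrite big_enum [RHS]big_mkcond.
Qed.

Lemma red_weight_branches i j :
  red_weight M S i j = \sum_(p <- branches i j) Pw M i p j.
Proof. by rewrite big_branches. Qed.

Lemma red_edgeP i j : reflect (exists p, is_branch M S i p j) (red_edge M S i j).
Proof.
apply: (iffP existsP) => [[k /existsP[t bt]]|[p]]; first by exists t.
rewrite -mem_branches mem_filter => /andP[bp /allpairsPdep[k [t [_ _ pt]]]].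
by exists k; apply/existsP; exists t; rewrite -pt.
Qed.

Lemma nbranch_throughE v : nbranch_through M S v =
  (\sum_i \sum_j count (fun p => v \in branch_verts i p j) (branches i j))%N.
Proof.
apply: eq_bigr => i _; apply: eq_bigr => j _.
rewrite -sum1_count [RHS]big_mkcond big_branches; apply: eq_bigr => k _.
by rewrite -sum1_card big_mkcondr.
Qed.

Lemma nbranch_through_gt0 v :
  covered_by_branches M S -> (0 < nbranch_through M S v)%N.
Proof.
move=> /(_ v)[i [p [j [bp vp]]]]; rewrite nbranch_throughE (bigD1 i) //=.
rewrite (bigD1 j) //= !addn_gt0 -has_count; apply/orP; left; apply/orP; left.
by apply/hasP; exists p; rewrite ?mem_branches.
Qed.

(** Off [S], lying on a branch means lying in its interior; covering provides one such branch and
    independence excludes a second. *)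
Lemma nbranch_through_independent v :
  branches_independent M S -> covered_by_branches M S -> v \notin S ->
  nbranch_through M S v = 1%N.
Proof.
move=> indep /(_ v)[i [p [j [bp vp]]]] vS; rewrite nbranch_throughE.
have uniq_br i' p' j' : is_branch M S i' p' j' -> v \in branch_verts i' p' j' ->
    (i, p, j) = (i', p', j').
  move=> bp'; rewrite (branch_interior bp') // => vp'.
  move: vp; rewrite (branch_interior bp) // => vp.
  by apply/eqP; apply: contraTT vp' => /indep; apply.
rewrite (bigD1 i) //= (bigD1 j) //= [X in (_ + _ + X)%N]big1 => [|i' /eqP ii'].
  rewrite [X in (_ + X + _)%N]big1 => [|j' /eqP jj'].
    rewrite !addn0 (eq_in_count (a2 := pred1 p)) => [|p'].
      by rewrite count_uniq_mem ?branches_uniq // mem_branches bp.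
    rewrite mem_branches => bp' /=; apply/idP/eqP => [/(uniq_br _ _ _ bp')[]|->//].
    by [].
  apply/eqP; rewrite -leqn0 leqNgt -has_count; apply/hasPn => p'.
  rewrite mem_branches => bp'; apply/negP => /(uniq_br _ _ _ bp')[_ jj].
  exact: jj'.
rewrite big1 // => j' _.
apply/eqP; rewrite -leqn0 leqNgt -has_count; apply/hasPn => p'.
rewrite mem_branches => bp'; apply/negP => /(uniq_br _ _ _ bp')[ii].
by case: ii'.
Qed.

(** Double counting: an interior has no repetitions, so a vertex off [S] contributes one factor for
    each branch containing it. *)
Lemma prod_branches (R : comNzSemiRingType) (F : 'I_n -> R) :
  \prod_i \prod_j \prod_(p <- branches i j) \prod_(v <- p) F v =
  \prod_(v | v \notin S) F v ^+ nbranch_through M S v.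
Proof.
transitivity (\prod_i \prod_j \prod_(p <- branches i j)
    \prod_(v | v \notin S) F v ^+ (v \in branch_verts i p j)).
  apply: eq_bigr => i _; apply: eq_bigr => j _; apply: eq_big_seq => p.
  rewrite mem_branches => bp; have /and5P[_ _ /allP pS /= /andP[_ up] _] := bp.
  rewrite big_uniq // [RHS]big_mkcond [LHS]big_mkcond; apply: eq_bigr => v _.
  case: (boolP (v \in S)) => vS /=.
    by case: ifP => // /pS; rewrite vS.
  by rewrite (branch_interior bp) //; case: (v \in p).
transitivity (\prod_(v | v \notin S) \prod_i \prod_j \prod_(p <- branches i j)
    F v ^+ (v \in branch_verts i p j)).
  rewrite [RHS]exchange_big; apply: eq_bigr => i _.
  rewrite [RHS]exchange_big; apply: eq_bigr => j _.
  by rewrite [RHS]exchange_big.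
apply: eq_bigr => v _; rewrite nbranch_throughE expr_sum; apply: eq_bigr => i _.
rewrite expr_sum; apply: eq_bigr => j _.
rewrite -sum1_count [in RHS]big_mkcond expr_sum.
by apply: eq_bigr => p _; case: (v \in _).
Qed.

End Branches.

(** * Invariance under expansion *)

Lemma is_branch_nil (n : nat) (M : 'M[W]_n) (S : {set 'I_n}) (i j : 'I_n) :
  i \in S -> j \in S -> edge M i j -> is_branch M S i [::] j.
Proof. by move=> iS jS ij; apply/and5P; split=> //; apply/andP. Qed.

(** * Weights of a covered graph occur along branches *)

Section Covering.

Variables (n : nat) (M : 'M[W]_n) (S : {set 'I_n}).
Hypotheses (acyc : acyclic_off M S) (cov : covered_by_branches M S).

Let offS (u v : 'I_n) := (v \notin S) && (u != v).

Lemma path_from_base u : exists i p,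
  [/\ i \in S, path (edge M) i p, path offS i p & last i p = u].
Proof.
case: (boolP (u \in S)) => uS; first by exists u, [::].
have [i [p [j [bp]]]] := cov u; rewrite (branch_interior bp) // => up.
case/and5P: bp => iS _ pS uip; rewrite rcons_path => /andP[pth _].
have: path offS i p by rewrite -(acyclic_uniq acyc pth) pS.
case/splitPr: up pth {pS uip} => p1 p2.
rewrite -cat_rcons !cat_path => /andP[e1 _] /andP[e2 _].
by exists i, (rcons p1 u); split=> //; rewrite last_rcons.
Qed.

(** Follows the end of a branch through [v]. The default in [head j p] serves the case of [v] in
    [S], where [p] is empty and [j] is [v]. *)
Lemma path_to_base u v : edge M u v -> u != v -> exists j p,
  [/\ j \in S, path (edge M) u (rcons p j), path offS u p & head j p = v].
Proof.
move=> uv neq_uv.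
case: (boolP (v \in S)) => vS; first by exists v, [::]; rewrite /= uv.
have [i [p [j [bp]]]] := cov v; rewrite (branch_interior bp) // => vp.
case/and5P: bp => _ jS pS uip; rewrite rcons_path => /andP[pth pj].
have: path offS i p by rewrite -(acyclic_uniq acyc pth) pS.
case/splitPr: vp pth pj {pS uip} => p1 p2.
rewrite !cat_path last_cat /= => /and3P[_ _ e1] pj /and3P[_ _ e2].
exists j, (v :: p2); split=> //=; first by rewrite uv rcons_path e1.
by rewrite /offS vS neq_uv.
Qed.

(** Covering concerns vertices only, so an edge may join two different branches. Gluing the start of
    a branch up to [u], the edge, and the end of a branch from [v] yields a branch, since acyclicity
    prevents repetitions. The condition [w != 0] discards the zeros recorded by [Omega] for absent
    loops. *)
Lemma weight_set_branch w : weight_set M w <->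
  w != 0 /\ exists i p j, is_branch M S i p j /\ w \in Omega M i p j.
Proof.
split=> [[u [v [nz <-]]]|[nz [i [p [j [_ /mem_Omega_entry[u [v E]]]]]]]]; last first.
  by exists u, v; rewrite E.
split; first exact: nz.
move: nz; have [<-|neq_uv] := eqVneq u v => nz.
  case: (boolP (u \in S)) => uS.
    exists u, [::], u; split; last exact: mem_head.
    exact: (is_branch_nil uS uS nz).
  have [i [p [j [bp]]]] := cov u; rewrite (branch_interior bp) // => up.
  by exists i, p, j; split=> //; apply: mem_Omega_loop.
have [i [p [iS e1 o1 lp]]] := path_from_base u.
have [j [q [jS e2 o2 hq]]] := path_to_base nz neq_uv.
exists i, (p ++ q), j; split; last first.
  by have := mem_Omega_edge M i p q j; rewrite lp hq.
have ed : path (edge M) i (rcons (p ++ q) j) by rewrite rcons_cat cat_path e1 lp.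
have : path offS i (p ++ q) by rewrite cat_path o1 lp.
rewrite -(acyclic_uniq acyc) => [/andP[pqS Upq]|]; last first.
  by move: ed; rewrite rcons_path => /andP[].
by apply/and5P; split.
Qed.

End Covering.

(** * Transfer along the branch bijections *)

Section Expansion.

Variables (n N : nat) (M : 'M[W]_n) (S : {set 'I_n}).
Variables (X : 'M[W]_N) (emb : 'I_n -> 'I_N).
Hypothesis expX : is_branch_expansion M S X emb.

(** The bijection [b] preserves [Omega], hence transports every quantity that [Omega] determines,
    such as [Pw] or a product over interior loops. *)
Lemma big_branches_expansion (R : Type) (idx : R) (op : Monoid.com_law idx)
    (F : seq 'I_N -> R) (G : seq 'I_n -> R) i j :
  i \in S -> j \in S ->
  (forall q p, is_branch M S i p j ->
     Omega X (emb i) q (emb j) = Omega M i p j -> F q = G p) ->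
  \big[op/idx]_(q <- branches X (emb @: S) (emb i) (emb j)) F q =
  \big[op/idx]_(p <- branches M S i j) G p.
Proof.
move=> iS jS FG; have [_ [_ [/(_ i j iS jS)[b [bOm [b_inj b_surj]]] _]]] := expX.
rewrite (eq_big_seq (G \o b)) => [|q]; last first.
  by rewrite mem_branches => /bOm[bp]; apply: FG.
rewrite -(big_map b xpredT G); apply/perm_big/uniq_perm.
- rewrite map_inj_in_uniq ?branches_uniq // => q q'.
  by rewrite !mem_branches; apply: b_inj.
- exact: branches_uniq.
move=> p; rewrite mem_branches; apply/mapP/idP => [[q]|/b_surj[q bq <-]].
  by rewrite mem_branches => /bOm[bp _] ->.
by exists q; rewrite ?mem_branches.
Qed.

Lemma red_weight_expansion i j : i \in S -> j \in S ->
  red_weight X (emb @: S) (emb i) (emb j) = red_weight M S i j.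
Proof.
move=> iS jS; rewrite !red_weight_branches.
by apply: big_branches_expansion => // q p _; apply: Pw_Omega.
Qed.

Lemma red_edge_expansion i j : i \in S -> j \in S ->
  red_edge X (emb @: S) (emb i) (emb j) = red_edge M S i j.
Proof.
move=> iS jS; have [_ [_ [/(_ i j iS jS)[b [bOm [_ b_surj]]] _]]] := expX.
apply/red_edgeP/red_edgeP => [[q /bOm[bp _]]|[p /b_surj[q bq _]]].
  by exists (b q).
by exists q.
Qed.

(** Both sides are the product of [F] over the interior loops of all branches, because each vertex
    of [X] off the base lies on exactly one branch. [F] stays general to serve both the determinant
    and the vertex count. *)
Lemma prod_diagonal_expansion (R : comNzSemiRingType) (F : W -> R) :
  \prod_(x | x \notin emb @: S) F (X x x) =
  \prod_(v | v \notin S) F (M v v) ^+ nbranch_through M S v.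
Proof.
have [emb_inj [_ [_ [indep cov]]]] := expX.
rewrite -(prod_branches M S (fun v => F (M v v))).
transitivity (\prod_(x | x \notin emb @: S)
    F (X x x) ^+ nbranch_through X (emb @: S) x).
  by apply: eq_bigr => x xS; rewrite nbranch_through_independent.
rewrite -(prod_branches X (emb @: S) (fun x => F (X x x))).
(* Branches have their ends in the base set, so the products reduce to pairs in it; [emb] is known
   to be injective only there. *)
have restrict k (A : 'M[W]_k) (B : {set 'I_k})
    (H : 'I_k -> 'I_k -> seq 'I_k -> R) :
    \prod_i \prod_j \prod_(p <- branches A B i j) H i j p =
    \prod_(i in B) \prod_(j in B) \prod_(p <- branches A B i j) H i j p.
  have nobr i j : ~~ ((i \in B) && (j \in B)) -> branches A B i j = [::].
    move=> nB; case E: (branches A B i j) => [|p s] //.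
    have: p \in branches A B i j by rewrite E mem_head.
    by rewrite mem_branches => /and3P[iB jB _]; rewrite iB jB in nB.
  rewrite [RHS]big_mkcond; apply: eq_bigr => i _; case: (boolP (i \in B)) => iB.
    rewrite [RHS]big_mkcond; apply: eq_bigr => j _.
    by case: (boolP (j \in B)) => jB //; rewrite nobr ?big_nil // iB.
  by rewrite big1 // => j _; rewrite nobr ?big_nil // (negPf iB).
rewrite !restrict big_imset //=; apply: eq_bigr => i iS.
rewrite big_imset //=; apply: eq_bigr => j jS.
apply: big_branches_expansion => // q p _ /loops_Omega.
rewrite -(big_map (fun x => X x x) xpredT F) => ->.
by rewrite big_map.
Qed.

Lemma weight_set_expansion w : structural M S -> covered_by_branches M S ->
  weight_set X w <-> weight_set M w.
Proof.
move=> [_ [acyc _]] cov; have [_ [[_ [acycX _]] [bij [_ covX]]]] := expX.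
split=> [/(weight_set_branch acycX covX)|/(weight_set_branch acyc cov)].
  move=> [nz [i0 [q [j0 [bq]]]]];
  have /and3P[/imsetP[i iS Ei] /imsetP[j jS Ej] _] := bq.
  move: bq; rewrite {}Ei {}Ej => bq; have [b [bOm _]] := bij i j iS jS.
  have [bp ->] := bOm q bq => wp; apply/(weight_set_branch acyc cov).
  by split=> //; exists i, (b q), j.
move=> [nz [i [p [j [bp wp]]]]]; have /and3P[iS jS _] := bp.
have [b [bOm [_ b_surj]]] := bij i j iS jS; have [q bq Ep] := b_surj p bp.
apply/(weight_set_branch acycX covX); split=> //.
exists (emb i), q, (emb j); split=> //.
by have [_ ->] := bOm q bq; rewrite Ep.
Qed.

Lemma leq_card_expansion : covered_by_branches M S -> (n <= N)%N.
Proof.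
move=> cov; have [emb_inj _] := expX.
(* Giving every diagonal entry the value 2 turns both products into counts. *)
have := prod_diagonal_expansion (fun=> 2%N).
rewrite prodr_const => E.
have le2 : (2 ^ #|[predC S]| <= 2 ^ #|[predC emb @: S]|)%N.
  rewrite [X in (_ <= X)%N](_ : _ = \prod_(v | v \notin S) 2 ^+ nbranch_through M S v).
    rewrite -prod_nat_const; apply: leq_prod => v _.
    by rewrite natrXE -{1}(expn1 2) leq_exp2l // nbranch_through_gt0.
  by rewrite -E natrXE.
have := cardC (mem (emb @: S)); rewrite card_ord card_in_imset // => EN.
have := cardC (mem S); rewrite card_ord => En.
by rewrite leq_exp2l // -(leq_add2l #|S|) EN En in le2.
Qed.

Lemma det_expansion : structural M S -> covered_by_branches M S ->
  \det (X - lam%:M) = \det (M - lam%:M) *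
    \prod_(i | i \notin S) (M i i - lam) ^+ (nbranch_through M S i).-1.
Proof.
move=> strM cov; have [emb_inj [strX _]] := expX.
pose f (k : 'I_#|S|) : 'I_n := enum_val k.
have f_inj : injective f by exact: enum_val_inj.
have fS k : f k \in S by exact: enum_valP.
have embf_inj : injective (emb \o f).
  by move=> k l /emb_inj-/(_ (fS k) (fS l))/f_inj.
rewrite (det_isospectral_reduction strX embf_inj) ?card_in_imset //; last first.
  by move=> k; apply: imset_f.
rewrite (det_isospectral_reduction strM f_inj) // -mulrA; congr (_ * _).
  by congr (\det _); apply/matrixP=> k l; rewrite !mxE red_weight_expansion.
rewrite (prod_diagonal_expansion (fun w => w - lam)) -big_split.
(* By covering the exponent is positive, so [.-1] does split one factor off the power. *)
apply: eq_bigr => v _; rewrite /= -exprS prednK //.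
exact: nbranch_through_gt0.
Qed.

End Expansion.

(** * Existence of the expansion *)

Section Construction.

Variables (n : nat) (M : 'M[W]_n) (S : {set 'I_n}).

(** Interiors have at most [n] vertices, so [n.-bseq] holds them all and keeps the type finite.
    Being a branch is imposed later, in [copies]. *)
Let tag : Type := ('I_n * n.-bseq 'I_n * 'I_n)%type.
Let vertex : Type := ('I_n * option tag)%type.

Let interior (b : tag) : seq 'I_n := b.1.2.

(* A vertex is (v, None) for v in S, or (v, Some b) for the copy of the interior
   vertex v of the branch b; interiors being duplicate-free, v determines its
   position on b. *)
Let arc (x y : vertex) : bool :=
  match x.2, y.2 with
  | None, None => true
  | None, Some b => (x.1 == b.1.1) && (y.1 == head b.2 (interior b))
  | Some b, None => (y.1 == b.2) && (x.1 == last b.1.1 (interior b))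
  | Some b, Some b' => (b == b') && ((x.1 == y.1) ||
      (index y.1 (interior b) == (index x.1 (interior b)).+1))
  end.

Let arc_loop x : arc x x.
Proof. by case: x => v [b|]; rewrite /arc //= !eqxx. Qed.

(** Chords of [M] between non-consecutive vertices of an interior get weight 0 through [arc]; if
    kept, they could create additional branches. *)
Let wt (x y : vertex) : W := if arc x y then M x.1 y.1 else 0.

Let edge_wt (x y : vertex) : bool := wt x y != 0.

Let edge_wtE x y : edge_wt x y = arc x y && edge M x.1 y.1.
Proof. by rewrite /edge_wt /wt; case: (arc x y) => //; rewrite eqxx. Qed.

Let copies : {set vertex} := [set x |
  if x.2 is Some b
  then is_branch M S b.1.1 (interior b) b.2 && (x.1 \in interior b)
  else x.1 \in S].

Let copy (b : tag) (v : 'I_n) : vertex := (v, Some b).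

Let copies_base v : ((v, None) \in copies) = (v \in S).
Proof. by rewrite inE. Qed.

Let copies_copy b v : (copy b v \in copies) =
  is_branch M S b.1.1 (interior b) b.2 && (v \in interior b).
Proof. by rewrite inE. Qed.

(** On the copy of [b], a path without repetitions can only advance to the next interior vertex or
    leave from the last one to [b.2]. The prefix [p1] records the position of [v]. *)
Let trace_branch (b : tag) p1 v p2 q j' :
  is_branch M S b.1.1 (interior b) b.2 -> interior b = p1 ++ v :: p2 ->
  all (fun x => (x \in copies) && (x.2 != None)) q -> uniq (copy b v :: q) ->
  path edge_wt (copy b v) (rcons q (j', None)) ->
  q = map (copy b) p2 /\ j' = b.2.
Proof.
move=> bb; have ub : uniq (interior b) by case/and5P: bb => _ _ _ /= /andP[].
elim: q p1 v p2 => [|[w [b'|]] q IHq] p1 v p2 Eb; last by rewrite /= andbF.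
  move=> _ _; rewrite /= andbT edge_wtE => /andP[/andP[/= /eqP-> lst] _].
  (* The path leaves from [v], which is thus the last interior vertex; as the interior has no
     repetitions, [p2] is empty. *)
  split=> //; case: p2 Eb lst => // u p2 Eb; rewrite Eb last_cat /= => /eqP vu.
  move: ub; rewrite Eb cat_uniq /= => /and5P[_ _ + _ _].
  by rewrite {1}vu mem_last.
move=> qc; rewrite cons_uniq => /andP[vnq uq].
rewrite rcons_cons /= edge_wtE => /andP[/andP[/= /andP[/eqP bb' vw] _] pth].
case: _ / bb' qc vnq uq pth => /= /andP[]; rewrite inE andbT /= => /andP[_ wb] qc.
rewrite in_cons negb_or => /andP[neq _] uq pth.
have vE : index v (interior b) = size p1.
  by rewrite Eb index_pivot //; move: ub; rewrite Eb cat_uniq /= => /and4P[_ /norP[]].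
have {}vw : index w (interior b) = (size p1).+1.
  by case/orP: vw => [/eqP/= vw|/eqP->]; [case/eqP: neq; rewrite /copy vw | rewrite vE].
case: p2 Eb => [|u p2] Eb.
  by move: wb; rewrite -index_mem vw Eb size_cat addn1 ltnn.
have uw : u = w.
  by rewrite -(nth_index w wb) vw Eb nth_cat ltnNge leqnSn subSnn.
have [] := IHq (rcons p1 v) w p2 _ qc uq pth; first by rewrite cat_rcons -uw.
by move=> -> ->; rewrite uw.
Qed.

Let path_copy (b : tag) p1 v p2 :
  uniq (interior b) -> interior b = p1 ++ v :: p2 ->
  path (edge M) v (rcons p2 b.2) ->
  path edge_wt (copy b v) (rcons (map (copy b) p2) (b.2, None)).
Proof.
move=> ub; elim: p2 p1 v => [|u p2 IHp2] p1 v Eb /= /andP[vu pth].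
  by rewrite edge_wtE /= vu /arc /= Eb last_cat !eqxx.
rewrite (IHp2 (rcons p1 v)) ?cat_rcons // edge_wtE vu /arc /= eqxx andbT.
rewrite Eb -(cat_rcons v p1) index_pivot ?size_rcons ?cat_rcons ?index_pivot.
- by rewrite eqxx orbT.
- by move: ub; rewrite Eb cat_uniq /= => /and4P[_ /norP[]].
move: ub; rewrite Eb -cat_rcons cat_uniq => /and3P[_ + _].
by rewrite /= negb_or => /andP[].
Qed.

Variable s0 : 'I_n.
Hypothesis s0S : s0 \in S.

Let s0_copies : (s0, None) \in copies.
Proof. by rewrite copies_base. Qed.

Let N := #|copies|.
Let dec (x : 'I_N) : vertex := enum_val x.
(** [s0] makes [copies] nonempty and so [enc] total; it inverts [dec] only on [copies]. *)
Let enc (x : vertex) : 'I_N := enum_rank_in s0_copies x.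
Let emb (i : 'I_n) : 'I_N := enc (i, None).
Let X : 'M[W]_N := \matrix_(x, y) wt (dec x) (dec y).

Let dec_inj : injective dec. Proof. exact: enum_val_inj. Qed.
Let decP x : dec x \in copies. Proof. exact: enum_valP. Qed.
Let encK x : x \in copies -> dec (enc x) = x.
Proof. by move=> xc; rewrite /dec enum_rankK_in. Qed.

Let dec_emb i : i \in S -> dec (emb i) = (i, None).
Proof. by move=> iS; rewrite encK // copies_base. Qed.

Let mem_base x : (x \in emb @: S) = ((dec x).2 == None).
Proof.
apply/imsetP/eqP => [[i iS ->]|]; first by rewrite dec_emb.
move=> x2; have := decP x; rewrite inE x2 => xS.
exists (dec x).1 => //; apply: dec_inj; rewrite dec_emb //.
by case: (dec x) x2 => ? ? /= ->.
Qed.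

Let edgeX x y : edge X x y = edge_wt (dec x) (dec y).
Proof. by rewrite /edge mxE. Qed.

Let path_edgeX x q : path (edge X) x q = path edge_wt (dec x) (map dec q).
Proof. by elim: q x => //= y q IHq x; rewrite IHq edgeX. Qed.

Let loopX x : X x x = M (dec x).1 (dec x).1.
Proof. by rewrite mxE /wt arc_loop. Qed.

Let Omega_dec x q y : path (edge X) x (rcons q y) ->
  Omega X x q y = Omega M (dec x).1 (map (fun z => (dec z).1) q) (dec y).1.
Proof.
have XE z t : edge X z t -> X z t = M (dec z).1 (dec t).1.
  by rewrite edgeX edge_wtE mxE /wt => /andP[->].
elim: q x => [|z q IHq] x; first by rewrite /= andbT => /XE ->.
by move=> /andP[/XE xz pth]; rewrite /= xz loopX IHq.
Qed.

(** The first step either returns to the base, giving an empty interior, or enters the copy of some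
    [b] at its head, whence [trace_branch] forces the rest. *)
Let branch_dec i q j : i \in S -> j \in S ->
  is_branch X (emb @: S) (emb i) q (emb j) ->
  exists2 b : tag, is_branch M S b.1.1 (interior b) b.2 &
    [/\ b.1.1 = i, b.2 = j & map dec q = map (copy b) (interior b)].
Proof.
move=> iS jS /and5P[_ _ qS Uiq pth].
move: pth; rewrite path_edgeX map_rcons !dec_emb //.
move: Uiq; rewrite cons_uniq => /andP[_]; rewrite -(map_inj_uniq dec_inj).
have {qS} : all (fun x => (x \in copies) && (x.2 != None)) (map dec q).
  by apply/allP=> _ /mapP[x xq ->]; rewrite decP -mem_base (allP qS).
case: {q}(map dec q) => [_ _|[v [b|]] q]; last by rewrite /= andbF.
  rewrite /= andbT edge_wtE => /andP[_ ij].
  by exists (i, [bseq], j) => //; apply: is_branch_nil.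
move=> /andP[]; rewrite inE andbT /= => /andP[bb vb] qc Uq.
rewrite edge_wtE => /andP[/andP[/andP[/= /eqP-> /eqP vE] _] pth].
exists b => //; case Eb: (interior b) => [|u p2]; first by rewrite Eb in vb.
rewrite Eb /= in vE; rewrite {}vE in qc Uq pth *.
by have [-> ->] := trace_branch (p1 := [::]) bb Eb qc Uq pth.
Qed.

Let dec_branch (b : tag) : is_branch M S b.1.1 (interior b) b.2 ->
  exists2 q, is_branch X (emb @: S) (emb b.1.1) q (emb b.2) &
    map dec q = map (copy b) (interior b).
Proof.
move=> bb; have /and5P[iS jS pS ub pth] := bb.
have qE : map dec (map enc (map (copy b) (interior b))) = map (copy b) (interior b).
  rewrite -[RHS]map_id -map_comp; apply/eq_in_map => _ /mapP[v vb ->].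
  by rewrite /= encK // copies_copy bb.
exists (map enc (map (copy b) (interior b))) => //.
have qS : all (fun x => x \notin emb @: S) (map enc (map (copy b) (interior b))).
  apply/allP=> x xq; rewrite mem_base.
  have: dec x \in map (copy b) (interior b) by rewrite -qE map_f.
  by case/mapP=> v _ ->.
apply/and5P; split=> //; rewrite ?imset_f //.
  rewrite cons_uniq -(map_inj_uniq dec_inj) qE map_inj_uniq => [|v w [] //].
  move: ub => /= /andP[_ ->]; rewrite andbT.
  by apply/negP => /(allP qS); rewrite imset_f.
rewrite path_edgeX map_rcons qE !dec_emb //.
move: ub pth => /= /andP[_ ub].
case Eb: (interior b) => [|u p2] /=.
  by move=> /andP[e _]; rewrite edge_wtE e.
move=> /andP[iu pth]; rewrite edge_wtE iu /arc /= Eb !eqxx /=.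
by apply: (path_copy (p1 := [::])) => //; rewrite Eb.
Qed.

Let branch_dec_base x q y : is_branch X (emb @: S) x q y ->
  exists2 b : tag, is_branch M S b.1.1 (interior b) b.2 &
    [/\ x = emb b.1.1, y = emb b.2 & map dec q = map (copy b) (interior b)].
Proof.
move=> bq; have /and3P[/imsetP[i iS xE] /imsetP[j jS yE] _] := bq.
move: bq; rewrite xE yE => /(branch_dec iS jS)[b bb [<- <- qE]].
by exists b.
Qed.

(** The tag of a shared interior vertex names both branches, so they coincide. *)
Let X_independent : branches_independent X (emb @: S).
Proof.
move=> x q y x' q' y' /branch_dec_base[b _ [-> -> qE]].
move=> /branch_dec_base[b' _ [-> -> qE']] neq v vq.
apply: contra neq => vq'; have := map_f dec vq; have := map_f dec vq'.
rewrite qE qE' => /mapP[w' _ ->] /mapP[w _ [_ bb']].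
by rewrite bb' in qE' *; rewrite (inj_map dec_inj (etrans qE (esym qE'))).
Qed.

(** A copy lies on the branch of its tag. A vertex of [S] is on a branch of [M] only as an end, and
    the lifted branch keeps its ends. *)
Let X_covered : covered_by_branches M S -> covered_by_branches X (emb @: S).
Proof.
move=> cov x; have := decP x; case Ex: (dec x) => [v [b|]].
  rewrite copies_copy => /andP[/dec_branch[q bq qE] vb].
  exists (emb b.1.1), q, (emb b.2); split=> //.
  rewrite /branch_verts in_cons mem_rcons in_cons -(mem_map dec_inj) qE Ex.
  by rewrite map_f ?orbT.
rewrite copies_base => vS; have [i [p [j [bp]]]] := cov v.
have xE : x = emb v by apply: dec_inj; rewrite dec_emb.
have [q bq _] := @dec_branch (i, Bseq (size_branch bp), j) bp.
rewrite /branch_verts in_cons mem_rcons in_cons => vp.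
exists (emb i), q, (emb j); split=> //.
rewrite /branch_verts in_cons mem_rcons in_cons xE.
case/or3P: vp => [/eqP->|/eqP->|vp]; rewrite ?eqxx ?orbT //.
by have /and3P[_ _ /andP[/allP/(_ v vp)]] := bp; rewrite vS.
Qed.

Let X_acyclic : acyclic_off X (emb @: S).
Proof.
(* The position on the interior strictly increases along loopless edges between copies, which rules
   out cycles. *)
pose rank x := index (dec x).1 (if (dec x).2 is Some b then interior b else [::]).
have rank_lt x y : x \notin emb @: S -> y \notin emb @: S ->
    edge_noloop X x y -> (rank x < rank y)%N.
  rewrite !mem_base edge_noloopE edgeX edge_wtE /rank -(inj_eq dec_inj).
  case: (dec x) => v [b|] //; case: (dec y) => w [b'|] //= _ _.
  move=> /andP[neq /andP[/andP[/eqP bb' /orP[/eqP/= vw|/eqP E]] _]].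
    by case/eqP: neq; rewrite bb' vw.
  by rewrite -bb' E.
move=> x q xS qS _ pth.
have [lastS le_rank] : last x q \notin emb @: S /\ (rank x <= rank (last x q))%N.
  elim: q x xS qS pth => //= y q IHq x xS /andP[yS qS] /andP[xy pth].
  have [lS le] := IHq y yS qS pth; split=> //.
  exact: leq_trans (ltnW (rank_lt x y xS yS xy)) le.
by apply/negP => /(rank_lt _ _ lastS xS); rewrite ltnNge le_rank.
Qed.

Lemma branch_expansion_of : structural M S -> covered_by_branches M S ->
  exists (k : nat) (A : 'M[W]_k) (f : 'I_n -> 'I_k), is_branch_expansion M S A f.
Proof.
move=> [_ [_ Mnl]] cov; exists N, X, emb; split; last split; last split.
- by move=> i j iS jS /(congr1 dec); rewrite !dec_emb // => -[].
- split; first by apply/set0Pn; exists (emb s0); apply: imset_f.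
  split; first exact: X_acyclic.
  move=> x; rewrite mem_base loopX; have := decP x.
  case: (dec x) => v [b|] //; rewrite copies_copy => /andP[bb vb] _.
  by apply: Mnl; case/and5P: bb => _ _ /allP/(_ v vb).
- move=> i j iS jS; exists (map (fun x => (dec x).1)).
  have key q : is_branch X (emb @: S) (emb i) q (emb j) ->
      exists2 b : tag, b = (i, b.1.2, j) & is_branch M S i b.1.2 j /\
        map dec q = map (copy b) b.1.2.
    move=> /(branch_dec iS jS)[[[i' p] j'] bb [/= ii jj qE]].
    by rewrite -ii -jj; exists (i', p, j').
  have fstE q b : map dec q = map (copy b) b.1.2 ->
      map (fun x => (dec x).1) q = b.1.2.
    by move=> qE; rewrite (map_comp fst) qE -map_comp map_id.
  split; [|split].
  + move=> q bq; have [b _ [bb qE]] := key q bq; rewrite (fstE _ _ qE).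
    split=> //; case/and5P: bq => _ _ _ _ /Omega_dec->.
    by rewrite !dec_emb // (fstE _ _ qE).
  (* With the ends [i] and [j] fixed, a tag is determined by its interior, hence so are the lifted
     vertices. *)
  + move=> q q' /key[b bE [_ qE]] /key[b' bE' [_ qE']].
    rewrite (fstE _ _ qE) (fstE _ _ qE') => /val_inj pp.
    by apply: (inj_map dec_inj); rewrite qE qE' bE bE' pp.
  move=> p bp; have [q bq qE] := @dec_branch (i, Bseq (size_branch bp), j) bp.
  by exists q => //; apply: fstE qE.
split; first exact: X_independent.
exact: X_covered.
Qed.

End Construction.

Theorem theorem5 (n : nat) (M : 'M[W]_n) (S : {set 'I_n}) :
  structural M S -> covered_by_branches M S ->
  (exists (N : nat) (X : 'M[W]_N) (emb : 'I_n -> 'I_N),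
      is_branch_expansion M S X emb) /\
  (forall (N : nat) (X : 'M[W]_N) (emb : 'I_n -> 'I_N),
      is_branch_expansion M S X emb ->
      (forall w, weight_set X w <-> weight_set M w) /\
      (forall i j, i \in S -> j \in S ->
         red_edge X (emb @: S) (emb i) (emb j) = red_edge M S i j /\
         red_weight X (emb @: S) (emb i) (emb j) = red_weight M S i j) /\
      (n <= N)%N /\
      \det (X - lam%:M) =
        \det (M - lam%:M) *
        \prod_(i < n | i \notin S) (M i i - lam) ^+ (nbranch_through M S i).-1).
Proof.
move=> strM cov; split.
  have [/set0Pn[s0 s0S] _] := strM.
  exact: branch_expansion_of s0S strM cov.
move=> N X emb expX; split=> [w|].
  exact: weight_set_expansion expX _ strM cov.
split=> [i j iS jS|].
  by rewrite (red_edge_expansion expX) // (red_weight_expansion expX).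
split; [exact: leq_card_expansion expX cov | exact: det_expansion expX strM cov].
Qed.
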